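(* Let $n\ge2$ and let $S\in\mathbb{S}^n_+$. (1) The ML degree of the equicorrelation model $E_n$ is $3$. The critical points of the entropy loss are given by the solutions $\rho$ of the cubic equation $f_n(\rho)=0$, where $$f_n(\rho)=(n-1)\rho^3+\big((n-2)(a-1)-(n-1)b\big)\rho^2+(2a-1)\rho-b.$$ (2) The SSL degree of $E_n$ is $4$. The critical points of the symmetrized Stein's loss satisfy the quartic $$(n-1)^2\bar d\,\rho^4-2(n^2-3n+2)\bar d\,\rho^3+\big((n^2-6n+6)\bar d+(n-2)a-(n-1)b\big)\rho^2+2\big(a+(n-2)\bar d\big)\rho+\bar d-b=0.$$
   Context: $\mathbb{S}^n$ is the space of real symmetric $n\times n$ matrices with $\langle A,B\rangle=\mathrm{trace}(AB)$, $\mathbb{S}^n_+$ the set of positive definite ones. The entropy loss is $\Sigma\mapsto I(S\|\Sigma)=\langle S,\Sigma^{-1}\rangle-\log\det(S\Sigma^{-1})-n$ and the symmetrized Stein's loss is $\Sigma\mapsto L(\Sigma,S)=\frac12(\langle S,\Sigma^{-1}\rangle+\langle\Sigma,S^{-1}\rangle)-n$. The equicorrelation model $E_n$ is the set of positive definite matrices of the form $\Sigma=(1-\rho)I_n+\rho\mathbf{1}\mathbf{1}^T$, where $\mathbf{1}\in\mathbb{R}^n$ is the all-ones vector; that is, $E_n=(I_n+\mathcal{L})\cap\mathbb{S}^n_+$ with $\mathcal{L}=\mathrm{span}\{\mathbf{1}\mathbf{1}^T-I_n\}$. Points are identified with their parameter $\rho$. Write $W=S^{-1}$ and $K=\Sigma^{-1}$.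 Let $\overline S=\frac1{n!}\sum_P PSP^T$ and $\overline W=\frac1{n!}\sum_P PWP^T$, sums over all $n\times n$ permutation matrices $P$. Let $a,b$ be the diagonal and off-diagonal entries of $\overline S$, so $\overline S=(a-b)I_n+b\mathbf{1}\mathbf{1}^T$, and $\bar c,\bar d$ the diagonal and off-diagonal entries of $\overline W$, so $\overline W=(\bar c-\bar d)I_n+\bar d\mathbf{1}\mathbf{1}^T$. The critical points of the entropy loss are the (complex, invertible) $\Sigma$ with $\Sigma-I_n\in\mathcal{L}$ and $K-KSK\in\mathcal{L}^\perp$; those of the symmetrized Stein's loss are the ones with $\Sigma-I_n\in\mathcal{L}$ and $W-KSK\in\mathcal{L}^\perp$ (here $\mathcal{L}$ is complexified and $\perp$ is with respect to the bilinear trace form). For generic $S\in\mathbb{S}^n_+$, the ML degree, respectively the SSL degree, is the number of complex critical points of the entropy loss, respectively of the symmetrized Stein's loss. *)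

(* Defs.v *)
From HB Require Import structures.
From mathcomp Require Import all_boot all_order all_fingroup all_algebra.
From mathcomp Require Import boolp classical_sets functions cardinality reals.
From mathcomp Require Import complex.
From mathcomp Require Import mpoly.

Set Implicit Arguments.
Unset Strict Implicit.
Unset Printing Implicit Defensive.

Import Order.TTheory GRing.Theory Num.Theory.

Local Open Scope classical_set_scope.
Local Open Scope ring_scope.
Local Open Scope complex_scope.

Definition posdef (R : realType) (n : nat) (S : 'M[R]_n) : Prop :=
  S^T = S /\ forall x : 'cV[R]_n, x != 0 -> 0 < (x^T *m S *m x) 0 0.

(* Orthogonality for the bilinear trace form (no complex conjugation). *)
Definition trace_orthogonal (F : fieldType) (n : nat) (L : {vspace 'M[F]_n})
    (A : 'M[F]_n) : Prop :=
  forall B : 'M[F]_n, B \in L -> \tr (A *m B) = 0.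

Definition cplx_mx (R : realType) (n : nat) (A : 'M[R]_n) : 'M[R[i]]_n :=
  map_mx (real_complex R) A.

(* The model is (I + L) intersected with the positive definite cone; L is given
   already complexified. *)
Definition entropy_critical (R : realType) (n : nat) (L : {vspace 'M[R[i]]_n})
    (S : 'M[R]_n) : set 'M[R[i]]_n :=
  [set Sigma | let K := invmx Sigma in
    [/\ Sigma \in unitmx, Sigma - 1%:M \in L &
        trace_orthogonal L (K - K *m cplx_mx S *m K)]].

Definition stein_critical (R : realType) (n : nat) (L : {vspace 'M[R[i]]_n})
    (S : 'M[R]_n) : set 'M[R[i]]_n :=
  [set Sigma | let K := invmx Sigma in let W := cplx_mx (invmx S) in
    [/\ Sigma \in unitmx, Sigma - 1%:M \in L &
        trace_orthogonal L (W - K *m cplx_mx S *m K)]].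

(* P holds for all positive definite S outside a proper algebraic subset of the
   space of symmetric matrices: p is a polynomial in the n * n matrix entries
   that does not vanish identically on symmetric matrices. *)
Definition for_generic_posdef (R : realType) (n : nat) (P : 'M[R]_n -> Prop)
    : Prop :=
  exists p : {mpoly R[n * n]},
    (exists A : 'M[R]_n, A^T = A /\ p.@[mxvec A 0] != 0) /\
    (forall S : 'M[R]_n, posdef S -> p.@[mxvec S 0] != 0 -> P S).

Definition ML_degree_is (R : realType) (n : nat) (L : {vspace 'M[R[i]]_n})
    (d : nat) : Prop :=
  for_generic_posdef (fun S : 'M[R]_n => entropy_critical L S #= `I_d)%card.

Definition SSL_degree_is (R : realType) (n : nat) (L : {vspace 'M[R[i]]_n})
    (d : nat) : Prop :=
  for_generic_posdef (fun S : 'M[R]_n => stein_critical L S #= `I_d)%card.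

Definition equicorr_space (F : fieldType) (n : nat) : {vspace 'M[F]_n} :=
  <[const_mx 1 - 1%:M]>%VS.

Definition equicorr_mx (F : fieldType) (n : nat) (rho : F) : 'M[F]_n :=
  (1 - rho)%:M + rho *: const_mx 1.

Definition perm_avg (F : fieldType) (n : nat) (A : 'M[F]_n) : 'M[F]_n :=
  (n`!%:R)^-1 *: \sum_(s : 'S_n) (perm_mx s *m A *m (perm_mx s)^T).

Definition equicorr_cubic (F : fieldType) (n : nat) (a b rho : F) : F :=
  (n%:R - 1) * rho ^+ 3
  + ((n%:R - 2) * (a - 1) - (n%:R - 1) * b) * rho ^+ 2
  + (2 * a - 1) * rho - b.

Definition equicorr_quartic (F : fieldType) (n : nat) (a b d rho : F) : F :=
  (n%:R - 1) ^+ 2 * d * rho ^+ 4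
  - 2 * (n%:R ^+ 2 - 3 * n%:R + 2) * d * rho ^+ 3
  + ((n%:R ^+ 2 - 6 * n%:R + 6) * d + (n%:R - 2) * a - (n%:R - 1) * b)
    * rho ^+ 2
  + 2 * (a + (n%:R - 2) * d) * rho + d - b.

Lemma perm_avg_perm (F : fieldType) (n : nat) (A : 'M[F]_n) (t : 'S_n) i j :
  perm_avg A (t i) (t j) = perm_avg A i j.
Proof.
have E (s : 'S_n) k l : (perm_mx s *m A *m (perm_mx s)^T) k l = A (s k) (s l).
  by rewrite tr_perm_mx -row_permE -col_permE !mxE.
rewrite /perm_avg !mxE !summxE; congr (_ * _).
rewrite [RHS](reindex_inj (mulgI t)) /=.
by apply: eq_bigr => s _; rewrite !E !permM.
Qed.

Lemma perm_avg_form (F : fieldType) (n : nat) (A : 'M[F]_n) :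
  exists a b : F, perm_avg A = (a - b)%:M + b *: const_mx 1.
Proof.
have E m (x y : F) (i j : 'I_m) :
    ((x - y)%:M + y *: const_mx 1 : 'M[F]_m) i j = if i == j then x else y.
  by rewrite !mxE mulr1; case: eqP => _; rewrite ?subrK ?add0r.
case: n A => [|[|n]] A; first by exists 0, 0; apply/matrixP => [[]].
  by exists (perm_avg A 0 0), 0; apply/matrixP => i j; rewrite E !ord1.
exists (perm_avg A 0 0), (perm_avg A 0 1); apply/matrixP => i j.
rewrite E; case: (eqVneq i j) => [<-|ij].
  by rewrite -(perm_avg_perm A (tperm 0 i) 0 0) tpermL.
pose t := tperm 0 i.
have ti : t i = 0 by rewrite /t tpermR.
have tj0 : t j != 0 by rewrite -ti (inj_eq perm_inj) eq_sym.
rewrite -(perm_avg_perm A t i j) ti -(perm_avg_perm A (tperm 1 (t j)) 0 (t j)).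
by rewrite tpermR tpermD.
Qed.

(* Main.v *)
Require Import Defs.
From mathcomp Require Import all_boot all_order all_fingroup all_algebra.
From mathcomp Require Import boolp classical_sets functions cardinality reals.
From mathcomp Require Import complex.
From mathcomp Require Import mpoly.
From mathcomp Require Import finmap separable ring.

Import Order.TTheory GRing.Theory Num.Theory.

Local Open Scope classical_set_scope.
Local Open Scope ring_scope.
Local Open Scope complex_scope.

(** Everything happens in the commutative algebra spanned by the two orthogonal
    projectors P = J / n (onto the all-ones vector, J = 11^T) and Q = I - P.
    Write m = n - 1 and [spec_mx x y] = x P + y Q.  The model is
    Sigma = spec_mx u v with u = 1 + m rho and v = 1 - rho, so that
    K = spec_mx (1/u) (1/v), and the direction J - I of the model is
    spec_mx m (-1).  A gradient condition is a single trace against this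
    direction, and after cycling K through the trace it involves S only through
    alpha = tr(S P) and beta = tr(S Q) / m, the two eigenvalues a + (n-1) b and
    a - b of the averaged matrix ([ones_eig], [perp_eig], [eig_perm_avg]).
    With D = alpha(W) - beta(W) = n d, clearing denominators gives
      entropy:  u v^2 - u^2 v - alpha v^2 + beta u^2 = 0,
      Stein:    D u^2 v^2 - alpha v^2 + beta u^2 = 0,
    whose left-hand sides are n times the cubic and n times the quartic.

    Clearing denominators adds no solutions: for positive definite S both alpha
    and beta are positive, and then u = 0 forces v = 0 in either equation (and
    conversely), against u + m v = n.  So for every positive definite S the
    critical points are in bijection with all complex roots
    ([entropy_criticalE], [stein_criticalE]).

    It remains to see that the roots are generically simple.  For the cubic this
    is the classical discriminant, which does not vanish at S = I, where the
    cubic is m rho^3 + rho.  For the quartic, dividing by u^2 v^2 gives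
    alpha / u^2 - beta / v^2 = D with u + m v = n; at a double root the
    derivative yields alpha m v^3 = - beta u^3, and eliminating u and v leaves
      (alpha - m^2 beta - n^2 D)^3 = 27 m^2 n^2 alpha beta D
    ([stein_double_root]).  Since D is only a rational function of S, the
    polynomial witnessing genericity is obtained by clearing det S with the
    adjugate; it does not vanish at spec_mx (m^2 + 1) 1, where the two sides of
    the last relation have opposite signs. *)

Set Implicit Arguments.
Unset Strict Implicit.
Unset Printing Implicit Defensive.

(** * The algebra spanned by the identity and the all-ones matrix *)

(** The matrix with eigenvalue [x] on the all-ones vector and [y] on its
    orthogonal complement; these coordinates turn products into pointwise
    products. *)
Definition spec_mx {F : fieldType} {n : nat} (x y : F) : 'M[F]_n :=
  y%:M + ((x - y) / n%:R) *: const_mx 1.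

(** The eigenvalues of the permutation average of [A] (see [eig_perm_avg]),
    written with traces of [A] itself: this makes them visibly linear in the
    entries. *)
Definition ones_eig {F : fieldType} {n : nat} (A : 'M[F]_n) : F :=
  \tr (A *m const_mx 1) / n%:R.

Definition perp_eig {F : fieldType} {n : nat} (A : 'M[F]_n) : F :=
  (\tr A - ones_eig A) / (n%:R - 1).

Section Spectral.
Variables (F : numFieldType) (n : nat).
Hypothesis n_gt1 : (1 < n)%N.

Lemma n_neq0 : n%:R != 0 :> F.
Proof. by rewrite pnatr_eq0 -lt0n ltnW. Qed.

Lemma n_subr1_neq0 : n%:R - 1 != 0 :> F.
Proof. by rewrite subr_eq0 pnatr_eq1 gtn_eqF. Qed.

Lemma ones_mxK :
  (const_mx 1 : 'M[F]_n) *m (const_mx 1 : 'M_n) = n%:R *: const_mx 1.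
Proof.
apply/matrixP=> i j; rewrite !mxE mulr1 -[LHS]/(\sum_(_ < n) _).
under eq_bigr do rewrite !mxE mulr1.
by rewrite sumr_const card_ord.
Qed.

Lemma tr_ones_mx : \tr (const_mx 1 : 'M[F]_n) = n%:R.
Proof.
rewrite /mxtrace; under eq_bigr do rewrite mxE.
by rewrite sumr_const card_ord.
Qed.

Lemma spec_mxM (x y x' y' : F) :
  spec_mx x y *m spec_mx x' y' = spec_mx (x * x') (y * y') :> 'M[F]_n.
Proof.
rewrite /spec_mx mulmxDl !mulmxDr -!scalar_mxM -!scalemxAl -!scalemxAr.
rewrite ones_mxK !mul_scalar_mx !mul_mx_scalar !scalerA -!addrA -!scalerDl.
by congr (_ + _ *: _); field; exact: n_neq0.
Qed.

Lemma tr_spec_mx (x y : F) : (spec_mx x y : 'M[F]_n)^T = spec_mx x y.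
Proof. by rewrite /spec_mx linearD linearZ /= tr_scalar_mx trmx_const. Qed.

Lemma spec_mx11 : spec_mx 1 1 = 1%:M :> 'M[F]_n.
Proof. by rewrite /spec_mx subrr mul0r scale0r addr0. Qed.

(** If one eigenvalue is zero, the projector onto its eigenspace is killed by
    [spec_mx x y]; an off-diagonal entry, which exists because [1 < n], shows
    that this projector is not zero. *)
Lemma spec_mx_unitP (x y : F) :
  (spec_mx x y \in @unitmx F n) = (x != 0) && (y != 0).
Proof.
apply/idP/andP => [uS | [x0 y0]]; last first.
  have E : spec_mx x y *m spec_mx x^-1 y^-1 = 1%:M :> 'M[F]_n.
    by rewrite spec_mxM !divff // spec_mx11.
  by case/mulmx1_unit: E.
have H (x' y' : F) : x * x' = 0 -> y * y' = 0 -> spec_mx x' y' = 0 :> 'M[F]_n.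
  move=> xx yy; rewrite -[LHS](mulKmx uS) spec_mxM xx yy.
  by rewrite /spec_mx subrr mul0r scale0r addr0 raddf0 mulmx0.
split; apply/eqP => z0.
  have /matrixP/(_ (Ordinal (ltnW n_gt1)) (Ordinal n_gt1)) :
    spec_mx 1 0 = 0 :> 'M[F]_n by apply: H; rewrite ?z0 ?mul0r ?mulr0.
  rewrite !mxE /= mulr0n add0r subr0 mulr1 mul1r => /eqP.
  by rewrite invr_eq0 (negPf n_neq0).
have /matrixP/(_ (Ordinal (ltnW n_gt1)) (Ordinal n_gt1)) :
  spec_mx 0 1 = 0 :> 'M[F]_n by apply: H; rewrite ?z0 ?mul0r ?mulr0.
rewrite !mxE /= mulr0n add0r sub0r mulr1 mulN1r => /eqP.
by rewrite oppr_eq0 invr_eq0 (negPf n_neq0).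
Qed.

Lemma invmx_spec (x y : F) : x != 0 -> y != 0 ->
  invmx (spec_mx x y) = spec_mx x^-1 y^-1 :> 'M[F]_n.
Proof.
move=> x0 y0; have u : spec_mx x y \in @unitmx F n by rewrite spec_mx_unitP x0.
by rewrite -[RHS](mulKmx u) spec_mxM !divff // spec_mx11 mulmx1.
Qed.

Lemma tr_mul_spec (A : 'M[F]_n) (x y : F) :
  \tr (A *m spec_mx x y) = x * ones_eig A + y * ((n%:R - 1) * perp_eig A).
Proof.
rewrite /spec_mx mulmxDr mul_mx_scalar -scalemxAr mxtraceD !mxtraceZ.
rewrite /perp_eig [(_ - 1) * _]mulrC divfK ?n_subr1_neq0 // /ones_eig.
by field; exact: n_neq0.
Qed.

Lemma ones_eig_spec (x y : F) : ones_eig (spec_mx x y : 'M[F]_n) = x.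
Proof.
rewrite /ones_eig /spec_mx mulmxDl mul_scalar_mx -scalemxAl ones_mxK.
rewrite mxtraceD !mxtraceZ tr_ones_mx.
by field; exact: n_neq0.
Qed.

Lemma perp_eig_spec (x y : F) : perp_eig (spec_mx x y : 'M[F]_n) = y.
Proof.
rewrite /perp_eig ones_eig_spec /spec_mx mxtraceD mxtraceZ tr_ones_mx.
rewrite mxtrace_scalar -mulr_natr.
by field; rewrite n_neq0 n_subr1_neq0.
Qed.

Lemma equicorr_spec (rho : F) :
  equicorr_mx n rho = spec_mx (1 + (n%:R - 1) * rho) (1 - rho).
Proof.
rewrite /equicorr_mx /spec_mx; congr (_ + _ *: _).
by field; exact: n_neq0.
Qed.

Lemma equicorr_dir : const_mx 1 - 1%:M = spec_mx (n%:R - 1) (- 1) :> 'M[F]_n.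
Proof.
rewrite /spec_mx opprK subrK divff ?n_neq0 // scale1r addrC.
by rewrite raddfN.
Qed.

Lemma equicorr_inj : injective (@equicorr_mx F n).
Proof.
move=> r s /(congr1 perp_eig); rewrite !equicorr_spec !perp_eig_spec.
by move/addrI/oppr_inj.
Qed.

(** Matrices of the form [spec_mx x y] commute with permutation matrices, so
    they do not distinguish [A] from its conjugates. *)
Lemma perm_avg_tr_spec (A : 'M[F]_n) (x y : F) :
  \tr (perm_avg A *m spec_mx x y) = \tr (A *m spec_mx x y).
Proof.
have tr_perm (s : 'S_n) : \tr (perm_mx s *m A *m (perm_mx s)^T *m spec_mx x y)
    = \tr (A *m spec_mx x y).
  rewrite -!mulmxA mxtrace_mulC -!mulmxA; congr (\tr (A *m _)).
  rewrite tr_perm_mx /spec_mx mulmxDl mulmxDr.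
  rewrite mul_scalar_mx -scalemxAr -perm_mxM mulVg perm_mx1.
  rewrite -scalemxAl -scalemxAr scalemx1; congr (_ + _ *: _).
  have -> : const_mx 1 *m perm_mx s = const_mx 1 :> 'M[F]_n.
    by rewrite -[s]invgK -col_permE; apply/matrixP => i j; rewrite !mxE.
  by rewrite -row_permE; apply/matrixP => i j; rewrite !mxE.
rewrite /perm_avg -scalemxAl mxtraceZ mulmx_suml raddf_sum /=.
under eq_bigr do rewrite tr_perm.
rewrite sumr_const card_Sn -(mulr_natl (\tr _)) mulKf //.
by rewrite pnatr_eq0 -lt0n fact_gt0.
Qed.

Lemma eig_perm_avg (A : 'M[F]_n) (a b : F) :
  perm_avg A = (a - b)%:M + b *: const_mx 1 ->
  ones_eig A = a + (n%:R - 1) * b /\ perp_eig A = a - b.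
Proof.
have -> : (a - b)%:M + b *: const_mx 1
    = spec_mx (a + (n%:R - 1) * b) (a - b) :> 'M[F]_n.
  by rewrite /spec_mx; congr (_ + _ *: _); field; exact: n_neq0.
move=> E; have := perm_avg_tr_spec A 1 0; have := perm_avg_tr_spec A 0 1.
rewrite E !tr_mul_spec ones_eig_spec perp_eig_spec !mul1r !mul0r !addr0 !add0r.
by move=> /(mulfI n_subr1_neq0) -> ->.
Qed.

End Spectral.

(** * The critical equations in spectral coordinates *)

Section CriticalEquations.
Variables (F : numFieldType) (n : nat).
Hypothesis n_gt1 : (1 < n)%N.

Lemma equicorr_subr1P (Sigma : 'M[F]_n) :
  reflect (exists rho, Sigma = equicorr_mx n rho)
          (Sigma - 1%:M \in equicorr_space F n).
Proof.
have E rho : 1%:M + rho *: (const_mx 1 - 1%:M) = equicorr_mx n rho :> 'M[F]_n.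
  by rewrite /equicorr_mx scalerBr scalemx1 raddfB addrA addrAC.
apply: (iffP (vlineP _ _)) => -[rho]; last first.
  by move->; exists rho; rewrite -E addrC addKr.
by move=> h; exists rho; rewrite -E -h addrC subrK.
Qed.

Lemma trace_orthogonal_equicorr (A : 'M[F]_n) :
  trace_orthogonal (equicorr_space F n) A <->
  \tr (A *m spec_mx (n%:R - 1) (- 1)) = 0.
Proof.
rewrite -equicorr_dir //; split=> [h | h B /vlineP[k ->]].
  by apply: h; exact: memv_line.
by rewrite -scalemxAr mxtraceZ h mulr0.
Qed.

Lemma tr_conj_spec (A : 'M[F]_n) (x y z t : F) :
  \tr (spec_mx x y *m A *m spec_mx x y *m spec_mx z t)
  = \tr (A *m spec_mx (x ^+ 2 * z) (y ^+ 2 * t)).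
Proof.
rewrite -!mulmxA mxtrace_mulC -mulmxA !spec_mxM //.
by congr (\tr (_ *m spec_mx _ _)); ring.
Qed.

Lemma tr_entropy_gradient (A : 'M[F]_n) (u v : F) : u != 0 -> v != 0 ->
  let K := spec_mx u^-1 v^-1 in
  \tr ((K - K *m A *m K) *m spec_mx (n%:R - 1) (- 1)) * (u * v) ^+ 2
  = (n%:R - 1) * (u * v ^+ 2 - u ^+ 2 * v - ones_eig A * v ^+ 2
                  + perp_eig A * u ^+ 2).
Proof.
move=> u0 v0 /=; rewrite mulmxBl raddfB /= tr_conj_spec !tr_mul_spec //.
rewrite ones_eig_spec ?perp_eig_spec //.
by field; rewrite u0 v0.
Qed.

Lemma tr_stein_gradient (A W : 'M[F]_n) (u v : F) : u != 0 -> v != 0 ->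
  let K := spec_mx u^-1 v^-1 in
  \tr ((W - K *m A *m K) *m spec_mx (n%:R - 1) (- 1)) * (u * v) ^+ 2
  = (n%:R - 1) * ((ones_eig W - perp_eig W) * (u * v) ^+ 2
                  - ones_eig A * v ^+ 2 + perp_eig A * u ^+ 2).
Proof.
move=> u0 v0 /=; rewrite mulmxBl raddfB /= tr_conj_spec !tr_mul_spec //.
by field; rewrite u0 v0.
Qed.

Lemma equicorr_cubicE (a b rho : F) :
  let u := 1 + (n%:R - 1) * rho in let v := 1 - rho in
  u * v ^+ 2 - u ^+ 2 * v - (a + (n%:R - 1) * b) * v ^+ 2 + (a - b) * u ^+ 2
  = n%:R * equicorr_cubic n a b rho.
Proof. by rewrite /equicorr_cubic /=; ring. Qed.

Lemma equicorr_quarticE (a b d rho : F) :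
  let u := 1 + (n%:R - 1) * rho in let v := 1 - rho in
  n%:R * d * (u * v) ^+ 2 - (a + (n%:R - 1) * b) * v ^+ 2 + (a - b) * u ^+ 2
  = n%:R * equicorr_quartic n a b d rho.
Proof. by rewrite /equicorr_quartic /=; ring. Qed.

(** Both critical equations have this shape, with a different cofactor [w].  If
    one of [u], [v] vanishes then so does the other, contradicting
    [u + (n - 1) v = n]. *)
Lemma equicorr_root_unit (alpha beta w rho : F) :
  alpha != 0 -> beta != 0 ->
  let u := 1 + (n%:R - 1) * rho in let v := 1 - rho in
  u * v * w - alpha * v ^+ 2 + beta * u ^+ 2 = 0 -> (u != 0) && (v != 0).
Proof.
move=> a0 b0 u v E; have uv : u + (n%:R - 1) * v = n%:R.
  by rewrite /u /v; ring.
apply/andP; split; apply: contra_neq (n_neq0 F n_gt1) => z.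
  move: E uv; rewrite z !mul0r expr0n mulr0 addr0 sub0r add0r => /eqP.
  by rewrite oppr_eq0 mulf_eq0 (negPf a0) expf_eq0 /= => /eqP -> <-; rewrite mulr0.
move: E uv; rewrite z mulr0 mul0r expr0n mulr0 subr0 add0r mulr0 addr0 => /eqP.
by rewrite mulf_eq0 (negPf b0) expf_eq0 /= => /eqP -> <-.
Qed.

(** The part common to the two losses: [G K] is the gradient at [Sigma = K^-1],
    and [g] is what remains of its trace once denominators are cleared. *)
Lemma equicorr_critical_pointsE (G : 'M[F]_n -> 'M[F]_n) (g : F -> F) :
  (forall rho, let u := 1 + (n%:R - 1) * rho in let v := 1 - rho in
     u != 0 -> v != 0 ->
     \tr (G (spec_mx u^-1 v^-1) *m spec_mx (n%:R - 1) (- 1)) * (u * v) ^+ 2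
     = (n%:R - 1) * (n%:R * g rho)) ->
  (forall rho, g rho = 0 ->
     (1 + (n%:R - 1) * rho != 0) && (1 - rho != 0)) ->
  [set Sigma | [/\ Sigma \in unitmx, Sigma - 1%:M \in equicorr_space F n &
                   trace_orthogonal (equicorr_space F n) (G (invmx Sigma))]]
  = [set equicorr_mx n rho | rho in [set rho : F | g rho = 0]].
Proof.
move=> gradE root_unit; apply/seteqP; split.
  move=> Sigma [uS /equicorr_subr1P[rho E] /trace_orthogonal_equicorr T0].
  exists rho => //=; move: uS T0.
  rewrite E equicorr_spec // spec_mx_unitP // => /andP[u0 v0].
  rewrite invmx_spec // => T0; have /= := gradE _ u0 v0.
  rewrite T0 mul0r => /esym/eqP; rewrite !mulf_eq0.
  by rewrite (negPf (n_neq0 F n_gt1)) (negPf (n_subr1_neq0 F n_gt1)) => /eqP.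
move=> _ [rho /= g0 <-]; have /andP[u0 v0] := root_unit _ g0; split.
- by rewrite equicorr_spec // spec_mx_unitP // u0.
- by apply/equicorr_subr1P; exists rho.
- apply/trace_orthogonal_equicorr.
  rewrite equicorr_spec // invmx_spec //; have /= := gradE _ u0 v0.
  rewrite g0 !mulr0 => /eqP.
  by rewrite mulf_eq0 expf_eq0 /= mulf_eq0 (negPf u0) (negPf v0) !orbF => /eqP.
Qed.

End CriticalEquations.

(** * Critical points as complex roots *)

Section ComplexCriticalPoints.
Variables (R : realType) (n : nat).
Hypothesis n_gt1 : (1 < n)%N.

Lemma ones_eig_cplx (A : 'M[R]_n) : ones_eig (cplx_mx A) = (ones_eig A)%:C.
Proof.
rewrite /ones_eig fmorph_div rmorph_nat -trace_map_mx map_mxM.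
by rewrite map_const_mx rmorph1.
Qed.

Lemma perp_eig_cplx (A : 'M[R]_n) : perp_eig (cplx_mx A) = (perp_eig A)%:C.
Proof.
rewrite /perp_eig fmorph_div !rmorphB rmorph_nat rmorph1 ones_eig_cplx.
by rewrite trace_map_mx.
Qed.

Variables (S : 'M[R]_n) (a b : R).
Hypothesis avgS : perm_avg S = (a - b)%:M + b *: const_mx 1.
Hypothesis ones_neq0 : ones_eig S != 0.
Hypothesis perp_neq0 : perp_eig S != 0.

Lemma entropy_criticalE :
  entropy_critical (equicorr_space R[i] n) S =
  [set equicorr_mx n rho | rho in
     [set rho : R[i] | equicorr_cubic n a%:C b%:C rho = 0]].
Proof.
have [eS pS] := eig_perm_avg n_gt1 avgS.
have cub (rho : R[i]) :
    let u := 1 + (n%:R - 1) * rho in let v := 1 - rho in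
    u * v ^+ 2 - u ^+ 2 * v - ones_eig (cplx_mx S) * v ^+ 2
      + perp_eig (cplx_mx S) * u ^+ 2 = n%:R * equicorr_cubic n a%:C b%:C rho.
  rewrite ones_eig_cplx perp_eig_cplx eS pS -equicorr_cubicE.
  by rewrite !(rmorphB, rmorphD, rmorphM) rmorph_nat rmorph1.
apply: (equicorr_critical_pointsE n_gt1 (G := fun K => K - K *m cplx_mx S *m K)).
  by move=> rho u v u0 v0; rewrite tr_entropy_gradient // cub.
move=> rho f0; apply: (@equicorr_root_unit _ _ n_gt1 (ones_eig (cplx_mx S))
  (perp_eig (cplx_mx S)) ((1 - rho) - (1 + (n%:R - 1) * rho))).
- by rewrite ones_eig_cplx fmorph_eq0.
- by rewrite perp_eig_cplx fmorph_eq0.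
- by rewrite -[RHS](mulr0 n%:R) -f0 -cub; ring.
Qed.

Lemma stein_criticalE (c d : R) :
  perm_avg (invmx S) = (c - d)%:M + d *: const_mx 1 ->
  stein_critical (equicorr_space R[i] n) S =
  [set equicorr_mx n rho | rho in
     [set rho : R[i] | equicorr_quartic n a%:C b%:C d%:C rho = 0]].
Proof.
move=> avgW; have [eS pS] := eig_perm_avg n_gt1 avgS.
have [eW pW] := eig_perm_avg n_gt1 avgW.
set W := cplx_mx (invmx S); set D := ones_eig W - perp_eig W.
have quar (rho : R[i]) :
    let u := 1 + (n%:R - 1) * rho in let v := 1 - rho in
    D * (u * v) ^+ 2 - ones_eig (cplx_mx S) * v ^+ 2
      + perp_eig (cplx_mx S) * u ^+ 2
    = n%:R * equicorr_quartic n a%:C b%:C d%:C rho.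
  rewrite /D !ones_eig_cplx !perp_eig_cplx eS pS eW pW -equicorr_quarticE.
  rewrite !(rmorphB, rmorphD, rmorphM) rmorph_nat rmorph1 /=.
  by congr (_ * _ - _ + _); ring.
apply: (equicorr_critical_pointsE n_gt1 (G := fun K => W - K *m cplx_mx S *m K)).
  by move=> rho u v u0 v0; rewrite tr_stein_gradient // quar.
move=> rho f0; apply: (@equicorr_root_unit _ _ n_gt1 (ones_eig (cplx_mx S))
  (perp_eig (cplx_mx S)) (D * ((1 + (n%:R - 1) * rho) * (1 - rho)))).
- by rewrite ones_eig_cplx fmorph_eq0.
- by rewrite perp_eig_cplx fmorph_eq0.
- by rewrite -[RHS](mulr0 n%:R) -f0 -quar; ring.
Qed.

End ComplexCriticalPoints.

(** * Positivity of the averaged eigenvalues *)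

(** The trace of [S J] is the value of the quadratic form at the all-ones
    vector. *)
Lemma posdef_ones_eig_gt0 (R : realType) (n : nat) (S : 'M[R]_n) :
  (1 < n)%N -> posdef S -> 0 < ones_eig S.
Proof.
move=> n_gt1 [_ pS]; rewrite /ones_eig divr_gt0 ?ltr0n ?(ltnW n_gt1) //.
have -> : \tr (S *m const_mx 1)
    = ((const_mx 1 : 'cV_n)^T *m S *m (const_mx 1 : 'cV_n)) 0 0.
  rewrite -[RHS]trace_mx11 -mulmxA [RHS]mxtrace_mulC -mulmxA; congr (\tr (S *m _)).
  by apply/matrixP => i j; rewrite !mxE big_ord1 !mxE mulr1.
apply: pS; apply/eqP => /matrixP/(_ (Ordinal n_gt1) 0); rewrite !mxE.
by move/eqP; rewrite oner_eq0.
Qed.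

(** As [Q] is a symmetric idempotent, [tr (S Q) = tr (Q S Q)] is the sum of the
    values of the quadratic form at the columns of [Q]. *)
Lemma posdef_perp_eig_gt0 (R : realType) (n : nat) (S : 'M[R]_n) :
  (1 < n)%N -> posdef S -> 0 < perp_eig S.
Proof.
move=> n_gt1 [_ pS].
have n1 : 0 < n%:R - 1 :> R by rewrite subr_gt0 ltr1n.
rewrite -(pmulr_rgt0 _ n1); set Q : 'M[R]_n := spec_mx 0 1.
have -> : (n%:R - 1) * perp_eig S = \tr (S *m Q).
  by rewrite tr_mul_spec // mul0r add0r mul1r.
have QQ : Q *m Q = Q by rewrite spec_mxM // mul0r mul1r.
have QT : Q^T = Q by exact: tr_spec_mx.
rewrite -QQ mulmxA mxtrace_mulC mulmxA /mxtrace.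
have col_gt0 i : 0 < (Q *m S *m Q) i i.
  have -> : (Q *m S *m Q) i i = ((col i Q)^T *m S *m col i Q) 0 0.
    by rewrite tr_col QT colE mulmxA -!row_mul -colE [RHS]mxE [RHS]mxE.
  apply: pS; apply/eqP => /matrixP/(_ i 0); rewrite !mxE eqxx sub0r mulr1 mulN1r.
  by move/eqP; rewrite subr_eq0 eq_sym invr_eq1 pnatr_eq1 gtn_eqF.
rewrite (bigD1 (Ordinal n_gt1)) //= ltr_pwDl //.
by apply: sumr_ge0 => i _; exact: ltW.
Qed.

(** * Simple roots *)

Lemma card_roots_separable (F : closedFieldType) (p : {poly F}) (k : nat) :
  size p = k.+1 -> (forall x, root p x -> p^`().[x] != 0) ->
  ([set x | p.[x] = 0%R] #= `I_k)%card.
Proof.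
move=> szp simple; have p0 : p != 0 by rewrite -size_poly_eq0 szp.
have [rs pE] := closed_field_poly_normal p.
have lc0 : lead_coef p != 0 by rewrite lead_coef_eq0.
have rs_uniq : uniq rs.
  rewrite -separable_prod_XsubC -(eqp_separable (p := p)).
    by rewrite separable_poly.unlock; apply/Pdiv.ClosedField.coprimepP.
  by rewrite {1}pE eqp_scale.
have sz_rs : size rs = k.
  by move: szp; rewrite pE size_scale // size_prod_XsubC => -[].
have -> : [set x | p.[x] = 0] = [set` [fset x in rs]%fset].
  apply/seteqP; split=> x /=; rewrite ?inE.
    by move=> /rootP; rewrite pE rootZ // root_prod_XsubC.
  by rewrite -root_prod_XsubC -(rootZ _ _ lc0) -pE => /rootP.
by apply/card_eq_fsetP; rewrite card_fseq undup_id.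
Qed.

Definition cubic_disc (F : fieldType) (c3 c2 c1 c0 : F) : F :=
  c2 ^+ 2 * c1 ^+ 2 - 4 * c3 * c1 ^+ 3 - 4 * c2 ^+ 3 * c0
  + 18 * c3 * c2 * c1 * c0 - 27 * c3 ^+ 2 * c0 ^+ 2.

Lemma cubic_disc_morph (F G : fieldType) (h : {rmorphism F -> G})
    (c3 c2 c1 c0 : F) :
  h (cubic_disc c3 c2 c1 c0) = cubic_disc (h c3) (h c2) (h c1) (h c0).
Proof.
by rewrite /cubic_disc !(rmorph_nat, rmorphXn, rmorphB, rmorphD, rmorphM).
Qed.

(** A common root [x] of the cubic and its derivative determines [c1] and [c0]
    from [c3], [c2] and [x]; substituting them annihilates the discriminant. *)
Lemma card_cubic_roots (F : closedFieldType) (c3 c2 c1 c0 : F) :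
  c3 != 0 -> cubic_disc c3 c2 c1 c0 != 0 ->
  ([set x | c3 * x ^+ 3 + c2 * x ^+ 2 + c1 * x + c0 = 0%R] #= `I_3)%card.
Proof.
move=> c3_neq0 disc_neq0; pose p := Poly [:: c0; c1; c2; c3].
have pE x : p.[x] = c3 * x ^+ 3 + c2 * x ^+ 2 + c1 * x + c0.
  by rewrite horner_Poly /=; ring.
have dpE x : p^`().[x] = 3 * c3 * x ^+ 2 + 2 * c2 * x + c1.
  by rewrite /p /= !cons_poly_def !derivE !hornerE /=; ring.
under eq_set do rewrite -pE.
apply: card_roots_separable; first by rewrite /p (PolyK (c := 0)).
move=> x /rootP; rewrite pE dpE => p0; apply: contra_neq disc_neq0 => dp0.
have c1E : c1 = - (3 * c3 * x ^+ 2 + 2 * c2 * x).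
  by apply/eqP; rewrite -addr_eq0 addrC dp0.
have c0E : c0 = - (c3 * x ^+ 3 + c2 * x ^+ 2 + c1 * x).
  by apply/eqP; rewrite -addr_eq0 addrC p0.
by rewrite /cubic_disc c0E c1E; ring.
Qed.

(** Up to a nonzero constant and powers of [alpha], [beta] and [D], the
    discriminant of [D u^2 v^2 - alpha v^2 + beta u^2] restricted to the line
    [u + (N - 1) v = N]. *)
Definition stein_disc (F : fieldType) (N alpha beta D : F) : F :=
  (alpha - (N - 1) ^+ 2 * beta - N ^+ 2 * D) ^+ 3
  - 27 * (N - 1) ^+ 2 * N ^+ 2 * alpha * beta * D.

Lemma stein_disc_morph (F G : fieldType) (h : {rmorphism F -> G})
    (N alpha beta D : F) :
  h (stein_disc N alpha beta D) = stein_disc (h N) (h alpha) (h beta) (h D).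
Proof.
rewrite /stein_disc !(rmorph_nat, rmorphXn, rmorphB, rmorphD, rmorphM).
by rewrite rmorph1.
Qed.

(** The last equation is half the derivative of the quartic.  Combined with the
    quartic it gives [alpha (N - 1) v^3 = - beta u^3], hence both
    [D u^3 = N alpha] and, for [A = alpha - (N - 1)^2 beta - N^2 D],
    [A u^2 = - 3 (N - 1) N alpha v]; the discriminant is what is left after
    cubing the latter. *)
Lemma stein_double_root (F : fieldType) (N alpha beta D x : F) :
  N != 0 -> alpha != 0 -> beta != 0 ->
  let u := 1 + (N - 1) * x in let v := 1 - x in
  D * (u * v) ^+ 2 - alpha * v ^+ 2 + beta * u ^+ 2 = 0 ->
  D * u * v * ((N - 1) * v - u) + alpha * v + (N - 1) * beta * u = 0 ->
  stein_disc N alpha beta D = 0.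
Proof.
move=> N0 alpha0 beta0 u v q0 dq0.
have uvN : u + (N - 1) * v = N by rewrite /u /v; ring.
have cubes : alpha * (N - 1) * v ^+ 3 = - (beta * u ^+ 3).
  apply/eqP; rewrite -subr_eq0; apply/eqP.
  transitivity (u * v * (D * u * v * ((N - 1) * v - u) + alpha * v
      + (N - 1) * beta * u) - ((N - 1) * v - u)
        * (D * (u * v) ^+ 2 - alpha * v ^+ 2 + beta * u ^+ 2)).
    by ring.
  by rewrite q0 dq0; ring.
have v0 : v != 0.
  apply: contra_neq N0 => v0; move: cubes uvN; rewrite v0 expr0n !mulr0 addr0.
  move/esym/eqP; rewrite oppr_eq0 mulf_eq0 (negPf beta0) expf_eq0 /=.
  by move=> /eqP-> <-.
have u0 : u != 0.
  apply: contra_neq v0 => u0; move/eqP: q0.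
  rewrite u0 mul0r expr0n !mulr0 addr0 sub0r oppr_eq0 mulf_eq0 (negPf alpha0).
  by rewrite expf_eq0 => /eqP.
(* The quartic times [u], reduced with [cubes] and [u + (N - 1) v = N]. *)
have Du3 : D * u ^+ 3 = N * alpha.
  apply: (mulIf (expf_neq0 2 v0)); apply/eqP; rewrite -subr_eq0; apply/eqP.
  transitivity (u * (D * (u * v) ^+ 2 - alpha * v ^+ 2 + beta * u ^+ 2)
    - (alpha * (N - 1) * v ^+ 3 + beta * u ^+ 3)); first by rewrite /u /v; ring.
  by rewrite q0 cubes; ring.
set A := alpha - (N - 1) ^+ 2 * beta - N ^+ 2 * D.
(* [N^2] times the quartic, with [N^2] expanded as [(u + (N - 1) v)^2] in front
   of [alpha v^2 - beta u^2] and then reduced with [cubes]. *)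
have Au2 : A * u ^+ 2 = - 3 * (N - 1) * N * alpha * v.
  apply: (mulIf (expf_neq0 2 v0)); apply/eqP; rewrite -subr_eq0; apply/eqP.
  transitivity (- N ^+ 2 * (D * (u * v) ^+ 2 - alpha * v ^+ 2 + beta * u ^+ 2)
    + (u + 2 * (N - 1) * v) * (alpha * (N - 1) * v ^+ 3 + beta * u ^+ 3)).
    by rewrite /A /u /v; ring.
  by rewrite q0 cubes; ring.
apply: (mulIf (expf_neq0 6 u0)); rewrite mul0r.
transitivity ((A * u ^+ 2) ^+ 3
    - 27 * (N - 1) ^+ 2 * N ^+ 2 * alpha * beta * (D * u ^+ 3) * u ^+ 3).
  by rewrite /stein_disc -/A; ring.
rewrite Au2 Du3.
transitivity (- 27 * (N - 1) ^+ 2 * N ^+ 3 * alpha ^+ 2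
    * (alpha * (N - 1) * v ^+ 3 + beta * u ^+ 3)); first by ring.
by rewrite cubes; ring.
Qed.

Lemma card_stein_roots (F : numClosedFieldType) (n : nat) (alpha beta D : F) :
  (1 < n)%N -> alpha != 0 -> beta != 0 -> D != 0 ->
  stein_disc n%:R alpha beta D != 0 ->
  ([set x | D * ((1 + (n%:R - 1) * x) * (1 - x)) ^+ 2 - alpha * (1 - x) ^+ 2
            + beta * (1 + (n%:R - 1) * x) ^+ 2 = 0%R] #= `I_4)%card.
Proof.
move=> n_gt1 alpha0 beta0 D0 disc_neq0; set N : F := n%:R.
pose p := Poly [:: D - alpha + beta;
  2 * D * (N - 2) + 2 * alpha + 2 * (N - 1) * beta;
  D * ((N - 2) ^+ 2 - 2 * (N - 1)) - alpha + beta * (N - 1) ^+ 2;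
  - 2 * (N - 1) * (N - 2) * D; (N - 1) ^+ 2 * D].
have pE x : p.[x] = D * ((1 + (N - 1) * x) * (1 - x)) ^+ 2
    - alpha * (1 - x) ^+ 2 + beta * (1 + (N - 1) * x) ^+ 2.
  by rewrite horner_Poly /=; ring.
have dpE x : p^`().[x] = 2 * (D * (1 + (N - 1) * x) * (1 - x)
    * ((N - 1) * (1 - x) - (1 + (N - 1) * x)) + alpha * (1 - x)
    + (N - 1) * beta * (1 + (N - 1) * x)).
  by rewrite /p /= !cons_poly_def !derivE !hornerE /=; ring.
under eq_set do rewrite -pE.
apply: card_roots_separable.
  by rewrite /p (PolyK (c := 0)) //= mulf_neq0 // expf_neq0 // n_subr1_neq0.
move=> x /rootP; rewrite pE dpE => q0; apply: contra_neq disc_neq0 => /eqP.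
rewrite mulf_eq0 pnatr_eq0 /= => /eqP dq0.
by apply: (stein_double_root (n_neq0 F n_gt1) alpha0 beta0 q0 dq0).
Qed.

(** * Polynomial functions of the matrix entries *)

Definition mx_polynomial {R : realType} {n : nat} (f : 'M[R]_n -> R) : Prop :=
  exists p : {mpoly R[n * n]}, forall A, p.@[mxvec A 0] = f A.

Section PolynomialFunctions.
Variables (R : realType) (n : nat).
Implicit Types f g : 'M[R]_n -> R.

Lemma mx_polynomial_const (k : R) : mx_polynomial (fun _ : 'M[R]_n => k).
Proof. by exists k%:MP => A; rewrite mevalC. Qed.

Lemma mx_polynomial_entry (i j : 'I_n) :
  mx_polynomial (fun A : 'M[R]_n => A i j).
Proof. by exists 'X_(mxvec_index i j) => A; rewrite mevalXU mxvecE. Qed.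

Lemma mx_polynomialD f g : mx_polynomial f -> mx_polynomial g ->
  mx_polynomial (fun A => f A + g A).
Proof. by move=> [p pf] [q qg]; exists (p + q) => A; rewrite mevalD pf qg. Qed.

Lemma mx_polynomialM f g : mx_polynomial f -> mx_polynomial g ->
  mx_polynomial (fun A => f A * g A).
Proof. by move=> [p pf] [q qg]; exists (p * q) => A; rewrite mevalM pf qg. Qed.

Lemma mx_polynomialN f : mx_polynomial f -> mx_polynomial (fun A => - f A).
Proof. by move=> [p pf]; exists (- p) => A; rewrite mevalN pf. Qed.

Lemma mx_polynomialX f k : mx_polynomial f -> mx_polynomial (fun A => f A ^+ k).
Proof. by move=> [p pf]; exists (p ^+ k) => A; rewrite rmorphXn /= pf. Qed.

Lemma mx_polynomial_sum (I : Type) (r : seq I) (F : I -> 'M[R]_n -> R) :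
  (forall i, mx_polynomial (F i)) ->
  mx_polynomial (fun A => \sum_(i <- r) F i A).
Proof.
move=> pF; elim: r => [|i r [q qE]].
  by exists 0 => A; rewrite meval0 big_nil.
by have [p pE] := pF i; exists (p + q) => A; rewrite mevalD pE qE big_cons.
Qed.

Lemma mx_polynomial_prod (I : Type) (r : seq I) (F : I -> 'M[R]_n -> R) :
  (forall i, mx_polynomial (F i)) ->
  mx_polynomial (fun A => \prod_(i <- r) F i A).
Proof.
move=> pF; elim: r => [|i r [q qE]].
  by exists 1 => A; rewrite meval1 big_nil.
by have [p pE] := pF i; exists (p * q) => A; rewrite mevalM pE qE big_cons.
Qed.

Lemma mx_polynomial_det k (G : 'M[R]_n -> 'M[R]_k) :
  (forall i j, mx_polynomial (fun A => G A i j)) ->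
  mx_polynomial (fun A => \det (G A)).
Proof.
move=> pG; apply: mx_polynomial_sum => s; apply: mx_polynomialM.
  exact: mx_polynomial_const.
by apply: mx_polynomial_prod => i; exact: pG.
Qed.

Lemma mx_polynomial_adj_entry (i j : 'I_n) :
  mx_polynomial (fun A : 'M[R]_n => (\adj A) i j).
Proof.
have [p pE] : mx_polynomial (fun A : 'M[R]_n => cofactor A j i).
  apply: mx_polynomialM; first exact: mx_polynomial_const.
  apply: mx_polynomial_det => k l.
  have [q qE] := mx_polynomial_entry (lift j k) (lift i l).
  by exists q => A; rewrite qE !mxE.
by exists p => A; rewrite pE mxE.
Qed.

Lemma mx_polynomial_ones_eig (G : 'M[R]_n -> 'M[R]_n) :
  (forall i j, mx_polynomial (fun A => G A i j)) ->
  mx_polynomial (fun A => ones_eig (G A)).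
Proof.
move=> pG; apply: mx_polynomialM; last exact: mx_polynomial_const.
apply: mx_polynomial_sum => i.
have [p pE] : mx_polynomial (fun A => \sum_j G A i j * 1).
  apply: mx_polynomial_sum => j; apply: mx_polynomialM => //.
  exact: mx_polynomial_const.
by exists p => A; rewrite pE mxE; apply: eq_bigr => j _; rewrite mxE.
Qed.

Lemma mx_polynomial_perp_eig (G : 'M[R]_n -> 'M[R]_n) :
  (forall i j, mx_polynomial (fun A => G A i j)) ->
  mx_polynomial (fun A => perp_eig (G A)).
Proof.
move=> pG; apply: mx_polynomialM; last exact: mx_polynomial_const.
apply: mx_polynomialD; first by apply: mx_polynomial_sum => i; exact: pG.
by apply: mx_polynomialN; exact: mx_polynomial_ones_eig.
Qed.

Lemma for_generic_mx_polynomial (P : 'M[R]_n -> Prop) f (A : 'M[R]_n) :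
  mx_polynomial f -> A^T = A -> f A != 0 ->
  (forall S, posdef S -> f S != 0 -> P S) -> for_generic_posdef P.
Proof.
move=> [p pE] symA fA fP; exists p; split; first by exists A; rewrite pE.
by move=> S pS; rewrite pE; exact: fP.
Qed.

End PolynomialFunctions.

(* The specific lemmas come first, because [ones_eig] and [perp_eig] would
   otherwise be unfolded as products. *)
Ltac mx_polynomial_tac := repeat first
  [ exact: mx_polynomial_const | exact: mx_polynomial_entry
  | exact: mx_polynomial_adj_entry
  | apply: mx_polynomial_ones_eig => ? ? | apply: mx_polynomial_perp_eig => ? ?
  | apply: mx_polynomial_det => ? ?
  | apply: mx_polynomialX | apply: mx_polynomialN
  | apply: mx_polynomialD | apply: mx_polynomialM ].

(** * The ML and SSL degrees *)

Section Degrees.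
Variables (R : realType) (n : nat).
Hypothesis n_gt1 : (1 < n)%N.

(** At [S = I] the cubic is [(n - 1) rho^3 + rho], of discriminant
    [- 4 (n - 1)]. *)
Lemma ML_degree_equicorr : ML_degree_is (equicorr_space R[i] n) 3.
Proof.
(* The entries of the permutation average, recovered from its eigenvalues. *)
pose b (A : 'M[R]_n) := (ones_eig A - perp_eig A) / n%:R.
pose a (A : 'M[R]_n) := perp_eig A + b A.
pose c2 (A : 'M[R]_n) := (n%:R - 2) * (a A - 1) - (n%:R - 1) * b A.
have n0 := n_neq0 R n_gt1; have n1 := n_subr1_neq0 R n_gt1.
apply: (@for_generic_mx_polynomial _ _ _
  (fun A => cubic_disc (n%:R - 1) (c2 A) (2 * a A - 1) (- b A)) (spec_mx 1 1)).
- by rewrite /cubic_disc /c2 /a /b; mx_polynomial_tac.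
- exact: tr_spec_mx.
- rewrite /cubic_disc /c2 /a /b ones_eig_spec // perp_eig_spec //.
  rewrite (_ : _ - _ = - 4 * (n%:R - 1)); last by field.
  by rewrite mulf_neq0 // oppr_eq0 pnatr_eq0.
move=> S pS disc0; have [a' [b' avgS]] := perm_avg_form S.
have [eS qS] := eig_perm_avg n_gt1 avgS.
have bE : b S = b' by rewrite /b eS qS; field.
have aE : a S = a' by rewrite /a bE qS subrK.
rewrite (entropy_criticalE n_gt1 avgS); first last.
- by rewrite gt_eqF // posdef_perp_eig_gt0.
- by rewrite gt_eqF // posdef_ones_eig_gt0.
apply: card_eq_trans (inj_card_eq _) _.
  by move=> r s _ _ /(equicorr_inj n_gt1).
rewrite [X in (X #= _)%card](_ : _ = [set x | (n%:R - 1) * x ^+ 3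
  + (c2 S)%:C * x ^+ 2 + (2 * a S - 1)%:C * x + (- b S)%:C = 0]); last first.
  apply/seteqP; split=> x /=; rewrite /equicorr_cubic /c2 aE bE;
  rewrite !(rmorphB, rmorphD, rmorphM, rmorphN) !rmorph_nat rmorph1 => <-; ring.
apply: card_cubic_roots; first exact: n_subr1_neq0.
have -> : n%:R - 1 = (n%:R - 1)%:C :> R[i] by rewrite rmorphB rmorph_nat rmorph1.
by rewrite -cubic_disc_morph fmorph_eq0.
Qed.

(** The degree drops when [D = 0], and a root is repeated when [stein_disc]
    vanishes; the polynomial [f] below is the product of these two obstructions,
    made polynomial by a power of the determinant ([fE]).  Its factor [\det A]
    also makes [S] invertible, so that the adjugate computes [invmx S]. *)
Lemma SSL_degree_equicorr : SSL_degree_is (equicorr_space R[i] n) 4.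
Proof.
have n0 := n_neq0 R n_gt1; have n1 := n_subr1_neq0 R n_gt1.
pose delta (A : 'M[R]_n) := ones_eig (\adj A) - perp_eig (\adj A).
pose D (A : 'M[R]_n) := ones_eig (invmx A) - perp_eig (invmx A).
pose f (A : 'M[R]_n) := \det A * delta A
  * (((ones_eig A - (n%:R - 1) ^+ 2 * perp_eig A) * \det A
      - n%:R ^+ 2 * delta A) ^+ 3
     - 27 * (n%:R - 1) ^+ 2 * n%:R ^+ 2 * ones_eig A * perp_eig A
       * delta A * \det A ^+ 2).
have fE A : A \in unitmx ->
    f A = \det A ^+ 5 * D A * stein_disc n%:R (ones_eig A) (perp_eig A) (D A).
  move=> uA; have dA : \det A != 0 by rewrite -unitfE -unitmxE.
  have -> : D A = delta A / \det A.
    rewrite /D /delta /perp_eig /ones_eig /invmx uA -scalemxAl !mxtraceZ.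
    by field; rewrite dA n0 n1.
  by rewrite /f /stein_disc; field.
(* With [beta = 1] and [alpha = t] one has [alpha - (n - 1)^2 beta = 1] and
   [D = 1 / t - 1 < 0], which makes the cube positive and the term subtracted
   from it negative. *)
pose t : R := (n%:R - 1) ^+ 2 + 1.
have t1 : 1 < t by rewrite /t ltrDr exprn_even_gt0.
have t0 : t != 0 by rewrite gt_eqF // (lt_trans ltr01).
apply: (@for_generic_mx_polynomial _ _ _ f (spec_mx t 1)).
- by rewrite /f /delta; mx_polynomial_tac.
- exact: tr_spec_mx.
- have uA : spec_mx t 1 \in @unitmx R n by rewrite spec_mx_unitP // t0 oner_neq0.
  have Dt : D (spec_mx t 1) = t^-1 - 1.
    by rewrite /D invmx_spec ?oner_neq0 // invr1 ones_eig_spec ?perp_eig_spec.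
  have Dlt0 : t^-1 - 1 < 0 by rewrite subr_lt0 invf_lt1 // (lt_trans ltr01).
  rewrite fE // Dt ones_eig_spec ?perp_eig_spec //.
  have dA : \det (spec_mx t 1 : 'M[R]_n) != 0 by rewrite -unitfE -unitmxE.
  rewrite mulf_neq0 ?mulf_neq0 ?expf_neq0 ?(ltr0_neq0 Dlt0) //.
  rewrite gt_eqF // /stein_disc (_ : t - _ = 1); last by rewrite /t; ring.
  have nDlt0 : n%:R ^+ 2 * (t^-1 - 1) < 0.
    by rewrite pmulr_rlt0 // exprn_even_gt0.
  rewrite subr_gt0 (@lt_trans _ _ 0) //; last first.
    by rewrite exprn_gt0 // subr_gt0 (lt_trans nDlt0).
  rewrite pmulr_rlt0 // mulr1 !mulr_gt0 ?subr_gt0 ?ltr1n ?ltr0n ?(ltnW n_gt1) //.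
  exact: lt_trans ltr01 t1.
move=> S pS fS.
have uS : S \in unitmx.
  rewrite unitmxE unitfE; apply: contra_neq fS => detS.
  by rewrite /f detS !mul0r.
move: fS; rewrite fE // !mulf_eq0 !negb_or -andbA => /and3P[_ D0 disc0].
have [a [b avgS]] := perm_avg_form S.
have [c [d avgW]] := perm_avg_form (invmx S).
have [eS qS] := eig_perm_avg n_gt1 avgS.
have [eW qW] := eig_perm_avg n_gt1 avgW.
have e0 : ones_eig S != 0 by rewrite gt_eqF // posdef_ones_eig_gt0.
have q0 : perp_eig S != 0 by rewrite gt_eqF // posdef_perp_eig_gt0.
rewrite (stein_criticalE n_gt1 avgS e0 q0 avgW).
apply: card_eq_trans (inj_card_eq _) _.
  by move=> r s _ _ /(equicorr_inj n_gt1).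
have quar (x : R[i]) : n%:R * equicorr_quartic n a%:C b%:C d%:C x
    = (D S)%:C * ((1 + (n%:R - 1) * x) * (1 - x)) ^+ 2
      - (ones_eig S)%:C * (1 - x) ^+ 2
      + (perp_eig S)%:C * (1 + (n%:R - 1) * x) ^+ 2.
  rewrite -equicorr_quarticE /D eS qS eW qW.
  rewrite !(rmorphB, rmorphD, rmorphM) rmorph_nat rmorph1 /=.
  by congr (_ * _ - _ + _); ring.
have -> : [set x : R[i] | equicorr_quartic n a%:C b%:C d%:C x = 0]
    = [set x | n%:R * equicorr_quartic n a%:C b%:C d%:C x = 0].
  apply/seteqP; split=> x /= => [-> | /eqP]; first by rewrite mulr0.
  by rewrite mulf_eq0 (negPf (n_neq0 _ n_gt1)) => /eqP.
under eq_set do rewrite quar.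
apply: card_stein_roots; rewrite ?fmorph_eq0 //.
by rewrite -(rmorph_nat (real_complex R)) -stein_disc_morph fmorph_eq0.
Qed.

End Degrees.

Theorem theorem5p4 (R : realType) (n : nat) (hn : (1 < n)%N)
    (S : 'M[R]_n) (hS : posdef S) (a b c d : R)
    (hSbar : perm_avg S = (a - b)%:M + b *: const_mx 1)
    (hWbar : perm_avg (invmx S) = (c - d)%:M + d *: const_mx 1) :
  (ML_degree_is (equicorr_space R[i] n) 3 /\
   entropy_critical (equicorr_space R[i] n) S =
     [set equicorr_mx n rho | rho in
       [set rho : R[i] | equicorr_cubic n a%:C b%:C rho = 0]]) /\
  (SSL_degree_is (equicorr_space R[i] n) 4 /\
   stein_critical (equicorr_space R[i] n) S `<=`
     [set equicorr_mx n rho | rho in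
       [set rho : R[i] | equicorr_quartic n a%:C b%:C d%:C rho = 0]]).
Proof.
have e0 : ones_eig S != 0 by rewrite gt_eqF // posdef_ones_eig_gt0.
have q0 : perp_eig S != 0 by rewrite gt_eqF // posdef_perp_eig_gt0.
split; split.
- exact: ML_degree_equicorr.
- exact: entropy_criticalE.
- exact: SSL_degree_equicorr.
- by rewrite (stein_criticalE hn hSbar e0 q0 hWbar).
Qed.
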